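(* Let $L/k$ be a finite field extension of degree $m$, let $n\geq 1$ be an integer, and let $C\subset L^n$ be an $L$-linear subspace. If $m\geq n$, then there exists $\mathbf{c}\in C$ such that $$\mathrm{Rsupp}(C)=\mathrm{Rsupp}(\mathbf{c}).$$
   Context: Let $L/k$ be a finite field extension of degree $m$ and fix a $k$-basis $\alpha_1,\ldots,\alpha_m$ of $L$. For $\mathbf{c}=(c_1,\ldots,c_n)\in L^n$ write $c_j=\sum_{i=1}^m c_{ij}\alpha_i$ with $c_{ij}\in k$, and let $M(\mathbf{c})=(c_{ij})$, an $m\times n$ matrix over $k$. The rank support $\mathrm{Rsupp}(\mathbf{c})$ is the $k$-subspace of $k^n$ spanned by the rows of $M(\mathbf{c})$; it does not depend on the choice of the basis. For an $L$-linear subspace $C\subset L^n$, $\mathrm{Rsupp}(C)$ is the $k$-subspace of $k^n$ spanned by all the $\mathrm{Rsupp}(\mathbf{c})$, $\mathbf{c}\in C$. *)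

(* Defs.v *)
From mathcomp Require Import all_boot all_order all_algebra all_field.
From mathcomp Require Import boolp classical_sets.

Set Implicit Arguments.
Unset Strict Implicit.
Unset Printing Implicit Defensive.

Import GRing.Theory.
Local Open Scope classical_set_scope.
Local Open Scope ring_scope.

(* [span] in vector.v only takes finite sequences; this is the linear span of
   an arbitrary set, i.e., the union of the spans of its finite subfamilies. *)
Definition set_span (K : fieldType) (V : vectType K) (A : set V) : set V :=
  [set v | exists2 s : seq V, [set` s] `<=` A & v \in <<s>>%VS].

Definition coord_mx (k : fieldType) (L : fieldExtType k) (m n : nat)
    (alpha : m.-tuple L) (c : 'rV[L]_n) : 'M[k]_(m, n) :=
  \matrix_(i < m, j < n) coord alpha i (c 0 j).

Definition Rsupp (k : fieldType) (L : fieldExtType k) (m n : nat)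
    (alpha : m.-tuple L) (c : 'rV[L]_n) : {vspace 'rV[k]_n} :=
  <<[seq row i (coord_mx alpha c) | i : 'I_m]>>%VS.

Definition Rsupp_code (k : fieldType) (L : fieldExtType k) (m n : nat)
    (alpha : m.-tuple L) (C : {vspace 'rV[L]_n}) : set 'rV[k]_n :=
  set_span (\bigcup_(c in [set` C]) [set` Rsupp alpha c]).

(* Main.v *)
(** Write c.x for the L-valued product of c in L^n and x in k^n.  The orthogonal
   of Rsupp c is the kernel of x |-> c.x, so inclusion of rank supports amounts
   to reverse inclusion of these kernels.  Take c in C with Rsupp c of maximal
   dimension; it suffices that whenever d in C has Rsupp d not contained in
   Rsupp c, some L-combination of c and d has a larger rank support.
   - If k has q elements, some s in L makes the kernel of s c + d equal to the
     intersection of those of c and d: a bad s is of the form - d.x / c.x with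
     x <> 0 in k^n, so that there are at most q^n - 1 < q^m of them.
   - If k is infinite, choose x0 with c.x0 = 0 and d.x0 <> 0.  As
     dim Rsupp c < n <= m, after scaling d by an element of L, d.x0 lies outside
     the k-space of values of c; then c + mu d has larger rank support for all
     but finitely many mu in k, by a determinant argument. *)
Require Import Defs.
From mathcomp Require Import all_boot all_order all_algebra all_field.
From mathcomp Require Import boolp classical_sets.

Set Implicit Arguments.
Unset Strict Implicit.
Unset Printing Implicit Defensive.

Import GRing.Theory.
Local Open Scope classical_set_scope.
Local Open Scope ring_scope.

(** The columns of [cokermx B] are killed by [B], and [A] killing all of them already forces the
    inclusion of row spaces. *)
Lemma submx_colkerP (F : fieldType) (m1 m2 n : nat)
    (A : 'M[F]_(m1, n)) (B : 'M[F]_(m2, n)) :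
  (A <= B)%MS <-> forall x : 'cV[F]_n, B *m x = 0 -> A *m x = 0.
Proof.
split=> [/submxP[D ->] x Bx0|kerBA]; first by rewrite -mulmxA Bx0 mulmx0.
rewrite submxE; apply/eqP/matrixP => i j.
have /kerBA/matrixP/(_ i 0) : B *m col j (cokermx B) = 0.
  by rewrite colE mulmxA mulmx_coker mul0mx.
by rewrite colE mulmxA -colE !mxE.
Qed.

Lemma infinite_exists_nonroot (F : fieldType) (p : {poly F}) :
  (forall s : seq F, exists x, x \notin s) -> p != 0 -> exists x, ~~ root p x.
Proof.
move=> infF p0.
have [s ss us] : exists2 s : seq F, size s = size p & uniq s.
  elim: (size p) => [|N [s <- us]]; first by exists [::].
  by have [x xs] := infF s; exists (x :: s) => //=; rewrite xs.
have /allPn[x _ px] : ~~ all (root p) s.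
  by apply/negP => /(max_poly_roots p0)/(_ us); rewrite ss ltnn.
by exists x.
Qed.

(** Up to a nonzero factor the matrix is [- Z - mu^-1], so [mu^-1] only has to avoid the eigenvalues
    of [- Z]. *)
Lemma unitmx_addZ (F : fieldType) (n : nat) (Z : 'M[F]_n) :
  (forall s : seq F, exists x, x \notin s) ->
  exists2 mu : F, mu != 0 & 1%:M + mu *: Z \in unitmx.
Proof.
move=> infF.
(* The factor ['X] makes the nonroot [a] nonzero, so that it can be inverted. *)
have p0 : 'X * char_poly (- Z) != 0.
  by rewrite mulf_neq0 ?polyX_eq0 ?monic_neq0 ?char_poly_monic.
have [a] := infinite_exists_nonroot infF p0.
rewrite rootM negb_or -[root (char_poly _) _]eigenvalue_root_char rootX.
case/andP=> a0.
rewrite /eigenvalue /eigenspace negbK kermx_eq0 row_free_unit => Ua.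
exists a^-1; first by rewrite invr_eq0.
have -> : 1%:M + a^-1 *: Z = (- a^-1) *: (- Z - a%:M).
  by rewrite scaleNr scalerBr scalerN opprB opprK scale_scalar_mx mulVf.
by rewrite unitmxZ // unitfE oppr_eq0 invr_eq0.
Qed.

Lemma mxrank_addZ_gt (F : fieldType) (m n : nat) (A D : 'M[F]_(m, n))
    (x : 'cV[F]_n) :
  (forall s : seq F, exists x, x \notin s) ->
  A *m x = 0 -> ~~ ((D *m x)^T <= A^T)%MS ->
  exists mu : F, (\rank A < \rank (A + mu *: D)%R)%N.
Proof.
move=> infF Ax0 wA; set w := D *m x in wA.
(* The columns of X are mapped by A to a basis of its column space. *)
pose X := pinvmx (row_base A).
have AX : A *m X = col_base A.
  have : col_base A *m row_base A *m X = col_base A.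
    by rewrite -mulmxA mulmxVp ?row_base_free // mulmx1.
  by rewrite mulmx_base.
pose Q := row_mx (col_base A) w.
(* The columns of [Q] are independent, since [w] lies outside the column space of [A]; hence
   [pinvmx Q] is a left inverse of [Q]. *)
have Qfull : row_full Q.
  have cA : ((col_base A)^T :=: A^T)%MS.
    apply/eqmxP/andP; split; last first.
      by apply/submxP; exists (row_base A)^T; rewrite -trmx_mul mulmx_base.
    by rewrite -AX trmx_mul submxMl.
  have lt_AQ : (\rank A < \rank Q)%N.
    apply: (@leq_ltn_trans (\rank (col_base A)^T)).
      by rewrite cA mxrank_tr.
    rewrite -[X in (_ < X)%N]mxrank_tr tr_row_mx -addsmxE.
    apply: rank_ltmx; rewrite ltmxE addsmxSl /=.
    by rewrite cA; apply: contra wA => /(submx_trans (addsmxSr _ _)).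
  by rewrite /row_full eqn_leq rank_leq_col (leq_trans _ lt_AQ) ?addn1.
have [mu mu0 U] := unitmx_addZ (pinvmx Q *m row_mx (D *m X) 0) infF.
exists mu.
(* On the columns of X and mu^-1 x, A + mu D takes the values Q + mu [DX | 0]. *)
have : pinvmx Q *m ((A + mu *: D) *m row_mx X (mu^-1 *: x)) \in unitmx.
  rewrite mul_mx_row !mulmxDl AX -!scalemxAr Ax0 -!scalemxAl -/w.
  rewrite scaler0 add0r scalerA mulVf // scale1r.
  suff -> : row_mx (col_base A + mu *: (D *m X)) w =
            Q + mu *: row_mx (D *m X) 0.
    by rewrite mulmxDr -scalemxAr mulVpmx.
  by rewrite scale_row_mx scaler0 add_row_mx addr0.
rewrite -row_free_unit => /eqP rk.
apply: leq_trans (mxrankM_maxl _ (row_mx X (mu^-1 *: x))).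
by apply: leq_trans (mxrankM_maxr (pinvmx Q) _); rewrite rk addn1.
Qed.

(** With one vector removed, [f] takes at most [#|T| ^ n - 1] values; removing it is what settles
    the case [n = m]. *)
Lemma ex_notin_im_row (T : finType) (n m : nat) (x0 : T)
    (f : 'rV[T]_n -> 'rV[T]_m) :
  (n <= m)%N -> exists y, forall x, x <> const_mx x0 -> f x <> y.
Proof.
move=> nm.
have cA : (#|f @: [set~ const_mx x0]%SET| < #|[set: 'rV[T]_m]%SET|)%N.
  rewrite (leq_ltn_trans (leq_imset_card _ _)) //.
  rewrite cardsC1 cardsT !card_mx !mul1n.
  have T0 : (0 < #|T|)%N by apply/card_gt0P; exists x0.
  by rewrite prednK ?expn_gt0 ?T0 // leq_pexp2l.
have /subsetPn[y _ yf] :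
    ~~ ([set: 'rV[T]_m]%SET \subset f @: [set~ const_mx x0]%SET).
  by apply: contraL cA => /subset_leq_card; rewrite leqNgt.
exists y => x /eqP xx0; apply/eqP; apply: contraNneq yf => <-.
by apply: imset_f; rewrite !inE.
Qed.

(** The product c.x of the opening overview. *)
Definition evalmx (k : fieldType) (L : fieldExtType k) (n : nat)
    (c : 'rV[L]_n) (x : 'cV[k]_n) : L := \sum_j x j 0 *: c 0 j.

Lemma evalmxD (k : fieldType) (L : fieldExtType k) (n : nat)
    (s t : L) (c d : 'rV[L]_n) (x : 'cV[k]_n) :
  evalmx (s *: c + t *: d) x = s * evalmx c x + t * evalmx d x.
Proof.
rewrite /evalmx !mulr_sumr -big_split; apply: eq_bigr => j _ /=.
by rewrite !mxE scalerDr !scalerAr.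
Qed.

Section RankSupport.
Variables (k : fieldType) (L : fieldExtType k) (m n : nat) (alpha : m.-tuple L).

Lemma coord_mxE (c : 'rV[L]_n) (x : 'cV[k]_n) :
  coord_mx alpha c *m x = \col_i coord alpha i (evalmx c x).
Proof.
apply/colP => i; rewrite !mxE linear_sum; apply: eq_bigr => j _ /=.
by rewrite linearZ /= mxE mulrC.
Qed.

Lemma coord_mxDZ (mu : k) (c d : 'rV[L]_n) :
  coord_mx alpha (c + mu%:A *: d) = coord_mx alpha c + mu *: coord_mx alpha d.
Proof.
by apply/matrixP => i j; rewrite !mxE linearD -scalerAl mul1r linearZ.
Qed.

Lemma mem_Rsupp (c : 'rV[L]_n) (v : 'rV[k]_n) :
  (v \in Rsupp alpha c) = (v <= coord_mx alpha c)%MS.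
Proof.
rewrite /Rsupp; set A := coord_mx alpha c.
apply/idP/idP => [|/submxP[D ->]].
  rewrite -[X in <<X>>%VS]in_tupleE => /coord_span ->.
  apply: summx_sub => i _; apply: scalemx_sub.
  by have /mapP[j _ ->] := mem_nth 0 (ltn_ord i); exact: row_sub.
rewrite mulmx_sum_row memv_suml // => i _.
rewrite memvZ // memv_span //.
by apply: (map_f (fun i => row i A)); rewrite mem_enum.
Qed.

Hypothesis halpha : basis_of {:L} alpha.

Lemma coord_mx_eq0 (c : 'rV[L]_n) (x : 'cV[k]_n) :
  coord_mx alpha c *m x = 0 <-> evalmx c x = 0.
Proof.
rewrite coord_mxE; split=> [/colP e0|->]; last first.
  by apply/colP => i; rewrite !mxE linear0.
rewrite (coord_basis halpha (memvf (evalmx c x))) big1 // => i _.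
by have := e0 i; rewrite !mxE => ->; rewrite scale0r.
Qed.

Lemma coord_mx_subP (c d : 'rV[L]_n) :
  (coord_mx alpha d <= coord_mx alpha c)%MS <->
  forall x : 'cV[k]_n, evalmx c x = 0 -> evalmx d x = 0.
Proof.
rewrite submx_colkerP.
by split=> H x /coord_mx_eq0/H/coord_mx_eq0.
Qed.

Lemma rank_combination_finite (s : seq k) (c d : 'rV[L]_n) :
  (forall x, x \in s) -> (n <= m)%N ->
  ~~ (coord_mx alpha d <= coord_mx alpha c)%MS ->
  exists a b : L,
    (\rank (coord_mx alpha c) < \rank (coord_mx alpha (a *: c + b *: d)))%N.
Proof.
move=> sP nm dc.
have sP' : Finite.axiom (undup s).
  by move=> x; rewrite count_uniq_mem ?undup_uniq // mem_undup sP.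
pose T : finType := fin_type sP'.
(* Coordinates of the bad scalar attached to [x]. Where c.x = 0 the quotient is 0 by convention; [f]
   is only used where c.x is nonzero. *)
pose f (x : 'rV[k]_n) : 'rV[k]_m :=
  \row_i coord alpha i (- evalmx d x^T / evalmx c x^T).
have [y fy] := @ex_notin_im_row T n m (0 : k) f nm.
pose a := \sum_i y 0 i *: alpha`_i.
exists a, 1; set e := _ + _.
have good x : evalmx e x = 0 -> evalmx c x = 0 /\ evalmx d x = 0.
  rewrite evalmxD mul1r => e0.
  have [c0|c0] := eqVneq (evalmx c x) 0.
    by move: e0; rewrite c0 mulr0 add0r.
  have : x^T <> 0.
    move=> x0; case/eqP: c0; rewrite /evalmx big1 // => j _.
    by have := congr1 (fun y : 'rV[k]_n => y 0 j) x0; rewrite !mxE => ->;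
      rewrite scale0r.
  move/fy; case; apply/rowP => i; rewrite mxE trmxK.
  have -> : - evalmx d x / evalmx c x = a.
    by apply: (mulIf c0); rewrite divfK //; apply/eqP;
      rewrite eq_sym -addr_eq0 e0.
  by rewrite coord_sum_free // (basis_free halpha).
have ce : (coord_mx alpha c <= coord_mx alpha e)%MS.
  by apply/coord_mx_subP => x /good[].
have de : (coord_mx alpha d <= coord_mx alpha e)%MS.
  by apply/coord_mx_subP => x /good[].
have : (coord_mx alpha c < coord_mx alpha e)%MS.
  by rewrite /ltmx ce; apply: contra dc; exact: submx_trans.
by rewrite ltmxErank => /andP[].
Qed.

Lemma rank_combination_infinite (c d : 'rV[L]_n) :
  (forall s : seq k, exists x, x \notin s) -> (n <= m)%N ->
  ~~ (coord_mx alpha d <= coord_mx alpha c)%MS ->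
  exists a b : L,
    (\rank (coord_mx alpha c) < \rank (coord_mx alpha (a *: c + b *: d)))%N.
Proof.
move=> infk nm dc.
have [x c0 d0] : exists2 x, evalmx c x = 0 & evalmx d x != 0.
  apply/exists2P; apply: contrapT => /forallNP H.
  move/negP: dc; apply; apply/coord_mx_subP => x c0.
  by apply: contrapT => /eqP d0; apply: (H x).
have rn : (\rank (coord_mx alpha c) < n)%N.
  rewrite ltn_neqAle rank_leq_col andbT.
  by apply: contra dc => fc; apply: submx_full.
(* The values of [c] on k^n form a k-space of dimension less than [m], so some basis element
   [alpha_i] is not among them. *)
have [i ic] : exists i, ~~ (row i (1%:M : 'M[k]_m) <= (coord_mx alpha c)^T)%MS.
  apply/existsP; rewrite -negb_forall; apply/negP => /forallP/row_subP.
  rewrite sub1mx /row_full mxrank_tr => /eqP rm.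
  by move: rn; rewrite rm ltnNge nm.
(* This scaling gives [t *: d] the value [alpha_i] at [x]. *)
pose t := alpha`_i / evalmx d x.
have [mu rmu] : exists mu : k, (\rank (coord_mx alpha c) <
    \rank (coord_mx alpha c + mu *: coord_mx alpha (t *: d))%R)%N.
  apply: (@mxrank_addZ_gt _ _ _ _ _ x) => //; first exact/coord_mx_eq0.
  rewrite coord_mxE -[t *: d]add0r -(scale0r 0) evalmxD mul0r add0r divfK //.
  suff -> : (\col_j coord alpha j alpha`_i)^T = row i (1%:M : 'M[k]_m) by [].
  by apply/rowP => j; rewrite !mxE coord_free ?(basis_free halpha).
by exists 1, (mu%:A * t); rewrite -scalerA scale1r coord_mxDZ.
Qed.

Lemma rank_combination (c d : 'rV[L]_n) :
  (n <= m)%N -> ~~ (coord_mx alpha d <= coord_mx alpha c)%MS ->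
  exists a b : L,
    (\rank (coord_mx alpha c) < \rank (coord_mx alpha (a *: c + b *: d)))%N.
Proof.
have [[s sP]|infk] := pselect (exists s : seq k, forall x, x \in s).
  exact: rank_combination_finite sP.
apply: rank_combination_infinite => s; apply: contrapT => ns.
apply: infk; exists s => x; apply: contrapT => xs.
by apply: ns; exists x; apply/negP.
Qed.

End RankSupport.

Theorem theorem3p1 (k : fieldType) (L : fieldExtType k) (m n : nat)
  (hm : \dim {:L} = m) (alpha : m.-tuple L) (halpha : basis_of {:L} alpha)
  (hn : (1 <= n)%N) (C : {vspace 'rV[L]_n}) (hmn : (n <= m)%N) :
  exists2 c : 'rV[L]_n, c \in C & Rsupp_code alpha C = [set` Rsupp alpha c].
Proof.
(* Ranks attained on [C], as a boolean predicate so that [ex_maxnP] applies. *)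
pose P r := `[< exists2 c, c \in C & \rank (coord_mx alpha c) = r >].
have exP : exists r, P r.
  exists (\rank (coord_mx alpha (0 : 'rV[L]_n))).
  by apply/asboolP; exists 0; rewrite ?mem0v.
have ubP r : P r -> (r <= n)%N by move=> /asboolP[c _ <-]; exact: rank_leq_col.
case: (ex_maxnP exP ubP) => r /asboolP[c cC <-] cmax.
exists c => //.
have sub d : d \in C -> (coord_mx alpha d <= coord_mx alpha c)%MS.
  move=> dC; apply: contraT => /(rank_combination halpha hmn)[a [b]].
  rewrite ltnNge cmax //; apply/asboolP; exists (a *: c + b *: d) => //.
  by rewrite memvD ?memvZ.
rewrite /Rsupp_code /set_span; apply/seteqP; split=> v /=.
  move=> [s sC]; apply/subvP/span_subvP => x /sC[d /= dC].
  by rewrite !mem_Rsupp => /submx_trans; apply; exact: sub.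
move=> vc; exists [:: v]; last by rewrite span_seq1 memv_line.
by move=> x /=; rewrite inE => /eqP ->; exists c.
Qed.
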